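(* For every $\gamma>0$ and every graph $H$ with chromatic number $r$ there is $n_0\in\mathbb{N}$ such that for every $n>n_0$, $$\mathrm{IR}(H, K_{1,n}) \leq (r-1)^2 n + \gamma n.$$
   Context: All graphs are finite and simple. $K_{1,n}$ denotes the star with $n$ edges. For graphs $F$, $H$, $G$, write $F \overset{\text{ind}}{\longrightarrow} (H,G)$ if for every coloring of the edges of $F$ with red and blue there is either a red induced copy of $H$ (a vertex set $S\subseteq V(F)$ with $F[S]\cong H$ and all edges of $F[S]$ red) or a blue induced copy of $G$ (defined analogously with blue). The induced Ramsey number $\mathrm{IR}(H,G)$ is the smallest number of vertices of a graph $F$ with $F \overset{\text{ind}}{\longrightarrow} (H,G)$. *)

(* Defs.v *)
From HB Require Import structures.
From mathcomp Require Import all_boot all_order all_algebra.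
From mathcomp Require Import reals.
Set Implicit Arguments. Unset Strict Implicit. Unset Printing Implicit Defensive.
Import Order.TTheory GRing.Theory Num.Theory.

Definition simple_graph (V : finType) (e : rel V) : Prop :=
  (forall x y, e x y = e y x) /\ (forall x, e x x = false).

Definition colorable (V : finType) (e : rel V) (k : nat) : Prop :=
  exists f : V -> 'I_k, forall x y, e x y -> f x != f y.

Definition chromatic_number (V : finType) (e : rel V) (r : nat) : Prop :=
  colorable e r /\ (forall k, colorable e k -> r <= k).

Definition star_rel (n : nat) : rel 'I_n.+1 :=
  fun x y => (x != y) && ((val x == 0) || (val y == 0)).

(* An induced copy of (T,eH) in (V,eF) all of whose edges have colour b
   under the edge colouring c (c u v = true means red, false means blue):
   an injective phi with eF (phi x) (phi y) = eH x y, i.e. F[phi(T)] ~ H. *)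
Definition mono_induced_copy (V T : finType) (eF : rel V) (c : rel V)
  (b : bool) (eH : rel T) : Prop :=
  exists phi : T -> V, injective phi /\
    (forall x y, eF (phi x) (phi y) = eH x y) /\
    (forall x y, eH x y -> c (phi x) (phi y) = b).

(* F -ind-> (H, G): every red/blue colouring of the edges of F (a symmetric
   relation c; only its values on edges matter) has a red induced H or a
   blue induced G. *)
Definition ind_arrows (V T1 T2 : finType) (eF : rel V) (eH : rel T1)
  (eG : rel T2) : Prop :=
  forall c : rel V, (forall u v, c u v = c v u) ->
    mono_induced_copy eF c true eH \/ mono_induced_copy eF c false eG.

(* IR(H,G) <= x : IR is the least order of a graph F with F -ind-> (H,G),
   so IR(H,G) <= x iff some such F has at most x vertices. *)
Definition IR_le (R : realType) (T1 T2 : finType) (eH : rel T1) (eG : rel T2)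
  (x : R) : Prop :=
  exists (N : nat) (eF : rel 'I_N),
    simple_graph eF /\ ind_arrows eF eH eG /\ (N%:R <= x)%R.
Arguments star_rel n : clear implicits.

(* Main.v *)
Require Import Defs.
From HB Require Import structures.
From mathcomp Require Import all_boot all_order all_algebra.
From mathcomp Require Import reals.
From mathcomp Require Import zify ring lra.
Import Order.TTheory GRing.Theory Num.Theory.
Local Open Scope ring_scope.
Set Implicit Arguments. Unset Strict Implicit. Unset Printing Implicit Defensive.

(** Let s = r - 1 >= 1. The host graph is (s+1)-partite: one layer is small and
    each of the other s has about s n (1 + eps) vertices, which gives the order
    s^2 n + gamma n. A vertex is (copy, (a, b)) with a, b in a fixed prime field,
    and vertices of distinct layers are joined unless a a' + b + b' lies in a set
    D of small density. Vertices with distinct a have exactly independent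
    non-neighbourhoods, so Chebyshev makes the non-edges quasirandom; taking
    many copies for large n keeps the field, and thus all error terms, fixed.

    Without a blue star every vertex has fewer than n blue neighbours in each
    layer, hence red degree above (1 - 1/s) of each large layer, so that a
    positive proportion of the transversals are red cliques. A subbox of the
    layers maximising e^k / |box|^(k-1), e being the number of red cliques in
    it, has many red cliques in every large sub-subbox, hence no
    large vertex set with low red degree into another large set. The red edges
    and the non-edges are then both dense enough in hereditary fashion to embed
    H greedily, vertex by vertex, with colour class i going to layer i. *)

(** * Greedy embedding with shrinking candidate sets *)

Section Embedding.
Local Open Scope nat_scope.
Variables (T V : finType) (R : T -> T -> rel V) (W : T -> {set V}).
Variables (E Q : nat).
Hypothesis R_sym : forall x y u v, R x y u v = R y x v u.
Hypothesis E_gt0 : 0 < E.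
Hypothesis W_gt0 : forall x, 0 < #|W x|.
Hypothesis leQ : #|T| * E ^ #|T| <= Q.

Definition nbhd x y u (B : {set V}) := [set v in B | R x y u v].
Definition atypical x y B :=
  [set u in W x | E * #|nbhd x y u B| < #|B|].

Hypothesis few_atypical : forall x y (B : {set V}), x != y ->
  B \subset W y -> #|W y| <= Q * #|B| -> Q * #|atypical x y B| < #|W x|.

(** [C x] holds the candidates still open for [x] after [j] vertices have been placed; each
    placement shrinks a candidate set by a factor of at most [E], which gives the invariant with
    [E ^ j]. Since [Q] exceeds all these losses, the atypical vertices cannot exhaust a candidate
    set. *)
Lemma embed_seq (s : seq T) (C : T -> {set V}) (j : nat) :
  uniq s -> j + size s <= #|T| ->
  (forall x, x \in s -> C x \subset W x /\ #|W x| <= E ^ j * #|C x|) ->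
  exists phi : T -> V, (forall x, x \in s -> phi x \in C x) /\
    (forall x y, x \in s -> y \in s -> x != y -> R x y (phi x) (phi y)).
Proof.
elim: s C j => [|x s IHs] C j.
  (* A point of [V] is available only from some [W x], so an empty [T] gets the vacuous function. *)
  move=> _ _ _; have [x _|T0] := pickP T; last first.
    by exists (fun x => False_rect _ (notF (esym (T0 x)))); split.
  have /card_gt0P[v _] := W_gt0 x.
  by exists (fun=> v); split.
move=> /= /andP[xNs us] js Cs.
have [CWx cWx] : C x \subset W x /\ #|W x| <= E ^ j * #|C x|.
  by apply: Cs; rewrite mem_head.
have ltjT : j < #|T| by apply: leq_trans js; rewrite addnS ltnS leq_addr.
have leEQ i : i <= #|T| -> E ^ i <= Q.
  move=> iT; apply: leq_trans leQ; have T0 : 0 < #|T| by lia.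
  by apply: leq_trans (leq_pmull _ T0); rewrite leq_pexp2l.
have few y : y \in s -> Q * #|atypical x y (C y)| < #|W x|.
  move=> ys; have [CWy cWy] : C y \subset W y /\ #|W y| <= E ^ j * #|C y|.
    by apply: Cs; rewrite inE ys orbT.
  apply: few_atypical => //; first by apply: contraNneq xNs => ->.
  by apply: leq_trans cWy _; rewrite leq_mul2r leEQ ?orbT // ltnW.
(* Otherwise the atypical sets cover [C x], so [Q * #|C x| <= size s * #|W x|]. With
   [#|T| * #|W x| <= Q * #|C x|] this forces [#|T| <= size s], but [x] itself is still to be
   placed. *)
have [u uC utyp] : exists2 u, u \in C x &
    forall y, y \in s -> u \notin atypical x y (C y).
  have [u /andP[uC /allP u_typ]|noU] := pickP [pred u in C x | all (fun y => u \notin atypical x y (C y)) s].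
    by exists u.
  have cover : C x \subset \bigcup_(y in [set y in s]) atypical x y (C y).
    apply/subsetP => u uC; have := noU u; rewrite /= uC /= => /negbT.
    by case/allPn=> y ys; rewrite negbK => ua; apply/bigcupP; exists y => //; rewrite inE.
  have bnd : Q * #|C x| <= \sum_(y in [set y in s]) #|W x|.
    apply: leq_trans (_ : Q * \sum_(y in [set y in s]) #|atypical x y (C y)| <= _).
      rewrite leq_mul2l; apply/orP; right.
      apply: leq_trans (subset_leq_card cover) _.
      by elim/big_ind2: _ => [|? ? ? ? le1 le2|//];
         rewrite ?cards0 // (leq_trans (leq_card_setU _ _)) ?leq_add.
    rewrite big_distrr /=; apply: leq_sum => y; rewrite inE => ys.
    exact: ltnW (few y ys).
  rewrite sum_nat_const cardsE (card_uniqP us) in bnd.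
  have le1 := leq_mul leQ (leqnn #|C x|).
  have Wx := W_gt0 x.
  have le2 : E ^ j <= E ^ #|T| by rewrite leq_pexp2l // ltnW.
  have le3 : #|T| * #|W x| <= size s * #|W x|.
    apply: leq_trans bnd; apply: leq_trans le1; rewrite -mulnA leq_mul2l.
    by apply/orP; right; apply: leq_trans cWx _; rewrite leq_mul2r le2 orbT.
  rewrite leq_pmul2r // in le3.
  by have := leq_trans js le3; rewrite addnS ltnNge leq_addl.
have [||y ys|phi [phiC phiR]] := IHs (fun y => nbhd x y u (C y)) j.+1 => //.
- by rewrite addSnnS.
- have [CWy cWy] : C y \subset W y /\ #|W y| <= E ^ j * #|C y|.
    by apply: Cs; rewrite inE ys orbT.
  split; first by apply: subset_trans CWy; apply/subsetP => v; rewrite inE => /andP[].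
  have := utyp y ys; rewrite inE (subsetP CWx) //= -leqNgt => le.
  by apply: leq_trans cWy _; rewrite expnSr -mulnA leq_mul2l le orbT.
exists (fun y => if y == x then u else phi y); split.
  move=> y; rewrite inE; case: eqP => [->//|_] /= ys.
  by have := phiC y ys; rewrite inE => /andP[].
move=> y z; rewrite !inE.
case: (altP (y =P x)) => [->|yx]; case: (altP (z =P x)) => [->|zx] //=.
- by rewrite eqxx.
- by move=> _ zs _; have := phiC z zs; rewrite inE => /andP[].
- by move=> ys _ _; rewrite R_sym; have := phiC y ys; rewrite inE => /andP[].
exact: phiR.
Qed.

Lemma embed : exists phi : T -> V, (forall x, phi x \in W x) /\
  (forall x y, x != y -> R x y (phi x) (phi y)).
Proof.
have [||x _|phi [phiW phiR]] := @embed_seq (enum T) W 0.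
- exact: enum_uniq.
- by rewrite -cardE.
- by rewrite mul1n.
exists phi; split=> [x|x y xy]; first by rewrite phiW ?mem_enum.
by rewrite phiR ?mem_enum.
Qed.

End Embedding.

(** * Boxes of transversals and the change of one coordinate *)

Definition upd (I : finType) (X : Type) (f : {ffun I -> X}) (i : I) (a : X) :
    {ffun I -> X} :=
  [ffun j => if j == i then a else f j].

Definition box (I V : finType) (W : {ffun I -> {set V}}) : {set {ffun I -> V}} :=
  [set x : {ffun I -> V} | [forall i, x i \in W i]].

Section Boxes.
Variables (I V : finType).
Implicit Types (W U : {ffun I -> {set V}}) (x : {ffun I -> V}) (A B : {set V}).

Lemma upd_id (X : Type) (f : {ffun I -> X}) i a : upd f i a i = a.
Proof. by rewrite ffunE eqxx. Qed.

Lemma upd_neq (X : Type) (f : {ffun I -> X}) i j a :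
  j != i -> upd f i a j = f j.
Proof. by rewrite ffunE => /negbTE->. Qed.

Lemma boxP W x : reflect (forall i, x i \in W i) (x \in box W).
Proof. by rewrite inE; apply: forallP. Qed.

Lemma box_sub W U : (forall i, W i \subset U i) -> box W \subset box U.
Proof.
move=> WU; apply/subsetP => x /boxP xW; apply/boxP => i.
exact: subsetP (WU i) _ (xW i).
Qed.

Lemma mem_box_upd W i A x : A \subset W i ->
  (x \in box (upd W i A)) = (x \in box W) && (x i \in A).
Proof.
move=> AW; apply/boxP/andP => [xW|[/boxP xW xA] j].
  have xiA : x i \in A by have := xW i; rewrite upd_id.
  split=> //; apply/boxP => j; have := xW j; rewrite ffunE.
  by case: eqP => // ->; apply: subsetP.
by rewrite ffunE; case: eqP => // ->.
Qed.

Lemma upd_box W i v x : x \in box W -> v \in W i -> upd x i v \in box W.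
Proof.
by move=> /boxP xW vW; apply/boxP => j; rewrite ffunE; case: eqP => // ->.
Qed.

(** Exchanging [x i] with [v] is an involution on the pairs [(x, v)], and it turns [f (upd x i v)]
    into [f x]. This is the tool for averaging over a single coordinate. *)
Lemma sum_upd W i (f : {ffun I -> V} -> nat) :
  (\sum_(x in box W) \sum_(v in W i) f (upd x i v) =
   #|W i| * \sum_(x in box W) f x)%N.
Proof.
rewrite pair_big /=.
pose h (p : {ffun I -> V} * V) := (upd p.1 i p.2, p.1 i).
have hK : involutive h.
  move=> [x v]; rewrite /h /= upd_id; congr pair.
  by apply/ffunP => j; rewrite !ffunE; case: eqP => // ->.
rewrite (reindex_inj (can_inj hK)) /=.
transitivity (\sum_(p | (p.1 \in box W) && (p.2 \in W i)) f p.1)%N.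
  apply: eq_big => [[x v]|[x v] _] /=; last first.
    by congr f; apply/ffunP => j; rewrite !ffunE; case: eqP => // ->.
  apply/andP/andP => -[/boxP xW vW]; split.
  - apply/boxP => j; have := xW j; rewrite ffunE; case: eqP => // ->//.
  - by have := xW i; rewrite upd_id.
  - by apply: upd_box => //; apply/boxP.
  - exact: xW.
rewrite -(pair_big (mem (box W)) (mem (W i)) (fun x _ => f x)) /=.
by rewrite big_distrr /=; apply: eq_bigr => x _; rewrite sum_nat_const.
Qed.

(** This is [sum_upd] for the indicator of [x i \in A]. The cross-multiplied form compares boxes
    without writing their sizes as products over [I]. *)
Lemma card_box_upd W i A : A \subset W i ->
  (#|W i| * #|box (upd W i A)| = #|A| * #|box W|)%N.
Proof.
move=> AW; have := sum_upd W i (fun x => (x i \in A)).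
rewrite (eq_bigr (fun=> #|A|)) => [|x _]; last first.
  rewrite -[RHS]sum1_card [RHS]big_mkcond [LHS]big_mkcond /=.
  apply: eq_bigr => v _; rewrite upd_id.
  by case: (boolP (v \in A)) => [vA|]; [rewrite (subsetP AW _ vA)|case: ifP].
rewrite sum_nat_const mulnC => ->; congr (_ * _)%N.
rewrite -[LHS]sum1_card [LHS]big_mkcond [RHS]big_mkcond /=; apply: eq_bigr => x _.
by rewrite mem_box_upd //; case: (x \in box W); case: (x i \in A).
Qed.

Lemma card_box_split (K : {set {ffun I -> V}}) W i A : A \subset W i ->
  (#|K :&: box W| =
   #|K :&: box (upd W i A)| + #|K :&: box (upd W i (W i :\: A))|)%N.
Proof.
move=> AW; rewrite -(cardsID (box (upd W i A)) (K :&: box W)).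
congr (_ + _)%N; apply: eq_card => x.
  rewrite !in_setI mem_box_upd //.
  by case: (x \in K); case: (x \in box W); rewrite ?andbF.
rewrite in_setD !in_setI !mem_box_upd ?subsetDl // in_setD.
case: (boolP (x \in box W)) => [/boxP xW|_]; last by rewrite !andbF.
by rewrite xW andbT; case: (x \in K); rewrite ?andbF.
Qed.

End Boxes.

(** * A subbox that is dense in cliques hereditarily *)

Section DenseBox.
Variable R : realFieldType.

Lemma bernoulli (t : R) k : 0 <= t -> 1 + k%:R * t <= (1 + t) ^+ k.
Proof.
move=> t0; elim: k => [|k IHk]; first by rewrite mul0r addr0 expr0.
have : (1 + t) * (1 + k%:R * t) <= (1 + t) * (1 + t) ^+ k.
  by rewrite ler_wpM2l // addr_ge0.
rewrite exprS; apply: le_trans; rewrite -natr1.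
have : 0 <= k%:R * t * t by rewrite !mulr_ge0.
nra.
Qed.

(* Weighted AM-GM for [y = (s^k * 1)^(1/(k+1))]. *)
Lemma root_le_linear (y s : R) k : 0 <= y -> 0 < s -> s <= 1 ->
  y ^+ k.+1 <= s ^+ k -> y <= s + k.+1%:R^-1.
Proof.
move=> y0 s0 s1 ys; rewrite leNgt; apply/negP => lt.
have k0 : 0 < k.+1%:R :> R by rewrite ltr0n.
have k1 : 1 + k%:R != 0 :> R by rewrite nat1r pnatr_eq0.
(* With this [t], [s * (1 + t)] is [s + (1 - s) / k.+1] and [s ^+ k.+1 * (1 + k.+1 * t)] is exactly
   [s ^+ k], so Bernoulli's inequality contradicts the bound on [y ^+ k.+1]. *)
pose t := (1 - s) / (k.+1%:R * s).
have t0 : 0 <= t by rewrite divr_ge0 ?mulr_ge0 ?subr_ge0 // ltW.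
have E : s + (1 - s) / k.+1%:R = s * (1 + t).
  by rewrite /t; field; rewrite k1 gt_eqF.
have : (s * (1 + t)) ^+ k.+1 < y ^+ k.+1.
  have s0' := ltW s0; rewrite ltr_pXn2r ?nnegrE ?mulr_ge0 ?addr_ge0 //.
  rewrite -E; apply: le_lt_trans lt; rewrite lerD2l ler_piMl //.
    by rewrite invr_ge0 ltW.
  by rewrite gerBl ltW.
rewrite ltNge => /negP; apply; rewrite (le_trans ys) // exprMn.
apply: le_trans (_ : s ^+ k.+1 * (1 + k.+1%:R * t) <= _); last first.
  by rewrite ler_wpM2l ?exprn_ge0 ?bernoulli // ltW.
rewrite exprS /t le_eqVlt; apply/orP; left; apply/eqP; field.
by rewrite k1 gt_eqF.
Qed.

Variables (I V : finType) (K : {set {ffun I -> V}}).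
Implicit Types (W U S : {ffun I -> {set V}}).

Local Notation e W := (#|K :&: box W|%:R : R).
Local Notation b W := (#|box W|%:R : R).

(* The maximiser of [e W ^+ k / b W ^+ k.-1] over all subboxes [W] of [U]. *)
Lemma max_box U k (d : R) : 0 < d -> (0 < #|box U|)%N -> d * b U <= e U ->
  exists W, [/\ forall i, W i \subset U i, d * b W <= e W,
    d ^+ k.+1 * b U <= b W &
    forall S, (forall i, S i \subset W i) ->
      e S <= e W * (b S / b W + k.+1%:R^-1)].
Proof.
move=> d0 U0 dU.
pose phi W := e W ^+ k.+1 / b W ^+ k.
pose P W := [forall i, W i \subset U i].
have PU : P U by apply/forallP.
have ecard W : e W <= b W by rewrite ler_nat subset_leq_card // subsetIr.
case: (Order.TotalTheory.arg_maxP phi PU) => W PW Wmax.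
have bU0 : 0 < b U by rewrite ltr0n.
have eU0 : 0 < e U by apply: lt_le_trans dU; rewrite mulr_gt0.
have phiU : 0 < phi U by rewrite divr_gt0 ?exprn_gt0.
have phiW : phi U <= phi W := Wmax U PU.
have eW0 : 0 < e W.
  rewrite lt0r ler0n andbT; apply/eqP => e0.
  by have := lt_le_trans phiU phiW; rewrite /phi e0 expr0n /= mul0r ltxx.
have bW0 : 0 < b W := lt_le_trans eW0 (ecard W).
(* The right side is [phi W], and [phi U] is at least the left side. As [b W <= b U], this bounds
   the density of [W] from below; as that density is at most 1, it also bounds the size of [W]. *)
have dens : d ^+ k.+1 * b U <= (e W / b W) ^+ k.+1 * b W.
  apply: le_trans (_ : phi U <= _).
    rewrite ler_pdivlMr ?exprn_gt0 // -mulrA -exprS -exprMn.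
    by rewrite ler_pXn2r // nnegrE ?mulr_ge0 // ltW.
  apply: le_trans phiW _; rewrite le_eqVlt; apply/orP; left; apply/eqP.
  by rewrite /phi expr_div_n exprSr [b W ^+ k.+1]exprSr; field; rewrite expf_neq0 gt_eqF.
have leW : b W <= b U by rewrite ler_nat subset_leq_card // box_sub //; apply/forallP.
exists W; split.
- exact/forallP.
- rewrite -ler_pdivlMr // leNgt; apply/negP => lt.
  have : (e W / b W) ^+ k.+1 * b W < d ^+ k.+1 * b U.
    apply: lt_le_trans (_ : d ^+ k.+1 * b W <= _).
      by rewrite ltr_pM2r // ltr_pXn2r // ?nnegrE ?divr_ge0 // ltW.
    by rewrite ler_pM2l // exprn_gt0.
  by rewrite ltNge dens.
- apply: le_trans dens _; rewrite -[leRHS]mul1r ler_pM2r //.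
  by rewrite exprn_ile1 ?divr_ge0 // ler_pdivrMr // mul1r.
move=> S SW.
have leS : b S <= b W by rewrite ler_nat subset_leq_card // box_sub.
(* [root_le_linear] needs a positive ratio [b S / b W], so the empty box, where [e S = 0], is
   treated apart. *)
have [S0|S0] := posnP #|box S|.
  have /eqP -> : e S == 0 by rewrite eq_le ler0n andbT; apply: le_trans (ecard S) _; rewrite S0.
  by rewrite mulr_ge0 ?addr_ge0 ?divr_ge0 ?invr_ge0.
have bS0 : 0 < b S by rewrite ltr0n.
have PS : P S.
  by apply/forallP => i; apply: subset_trans (SW i) _; move/forallP: PW.
have : phi S <= phi W := Wmax S PS.
rewrite /phi ler_pdivrMr ?exprn_gt0 // mulrAC ler_pdivlMr ?exprn_gt0 // => maxS.
(* Maximality says [(e S / e W) ^+ k.+1 <= (b S / b W) ^+ k]. *)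
rewrite mulrC -ler_pdivrMr //; apply: root_le_linear.
- by rewrite divr_ge0.
- by rewrite divr_gt0.
- by rewrite ler_pdivrMr // mul1r.
rewrite !expr_div_n ler_pdivrMr ?exprn_gt0 // mulrAC ler_pdivlMr ?exprn_gt0 //.
by rewrite [leRHS]mulrC.
Qed.

(** Split the maximiser [W] into the box [S] cut out by [A] and [B] and two further boxes [S1] and
    [S2]. Maximality caps the cliques in [S1] and [S2], so [S] keeps at least
    [e W * (b S / b W - 2 / k.+1)]. Since [b S / b W >= c ^+ 2 >= 4 / k.+1], the error costs at most
    half. *)
Lemma dense_box U k (c d : R) : 0 < d -> (0 < #|box U|)%N -> d * b U <= e U ->
  0 < c -> 4 <= k.+1%:R * c ^+ 2 ->
  exists W, [/\ forall i, W i \subset U i,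
    forall i, d ^+ k.+1 * #|U i|%:R <= #|W i|%:R,
    (0 < #|box W|)%N &
    forall i j (A B : {set V}), i != j -> A \subset W i -> B \subset W j ->
      c * #|W i|%:R <= #|A|%:R -> c * #|W j|%:R <= #|B|%:R ->
      d / 2 * b (upd (upd W i A) j B) <= e (upd (upd W i A) j B)].
Proof.
move=> d0 U0 dU c0 kc; have [W [WU dW W_large W_max]] := max_box k d0 U0 dU.
have bU0 : 0 < b U by rewrite ltr0n.
have bW0 : 0 < b W by apply: lt_le_trans W_large; rewrite mulr_gt0 ?exprn_gt0.
have cardW i : (0 < #|W i|)%N.
  have /card_gt0P[x /boxP xW] : (0 < #|box W|)%N by rewrite -(ltr0n R).
  by apply/card_gt0P; exists (x i).
exists W; split=> [//|i||i j A B ij AW BW cA cB].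
(* Restoring the other coordinates to those of [U] only enlarges the box, so [#|W i| / #|U i|] is at
   least [#|box W| / #|box U|]. *)
- have le : (#|box W| <= #|box (upd U i (W i))|)%N.
    apply/subset_leq_card/box_sub => l.
    by rewrite ffunE; case: eqP => // ->.
  have /(congr1 (fun n => n%:R : R)) := card_box_upd (WU i).
  rewrite !natrM => eqU.
  have : #|U i|%:R * b W <= #|W i|%:R * b U :> R.
    by rewrite -eqU ler_wpM2l // ler_nat.
  have := ler_wpM2l (ler0n R #|U i|) W_large.
  move=> h1 h2; rewrite -(ler_pM2r bU0); apply: le_trans h2.
  by apply: le_trans h1; rewrite mulrCA mulrA.
- by rewrite -(ltr0n R).
set S1 := upd W i (W i :\: A).
set WA := upd W i A.
have WAj : WA j = W j by rewrite upd_neq // eq_sym.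
have BWA : B \subset WA j by rewrite WAj.
set S := upd WA j B.
set S2 := upd WA j (WA j :\: B).
have WAW l : WA l \subset W l by rewrite ffunE; case: eqP => // ->.
have S1W l : S1 l \subset W l by rewrite ffunE; case: eqP => // ->; rewrite subsetDl.
have S2W l : S2 l \subset W l.
  by rewrite ffunE; case: eqP => // ->; rewrite WAj subsetDl.
have eW : e W = e S + e S2 + e S1.
  by rewrite (card_box_split K AW) (card_box_split K BWA) !natrD.
have bW : b W = b S + b S2 + b S1.
  have := card_box_split setT AW; have := card_box_split setT BWA.
  by rewrite !setTI => eq1; rewrite eq1 => ->; rewrite !natrD.
have s_large : c ^+ 2 * b W <= b S.
  have /(congr1 (fun n => n%:R : R)) := card_box_upd AW.
  have /(congr1 (fun n => n%:R : R)) := card_box_upd BWA.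
  rewrite !natrM WAj -/WA -/S => eqB eqA.
  have Wi : 0 < #|W i|%:R :> R by rewrite ltr0n.
  have Wj : 0 < #|W j|%:R :> R by rewrite ltr0n.
  have hA : c * b W <= b WA.
    by rewrite -(ler_pM2l Wi) eqA mulrCA mulrA ler_wpM2r.
  have hB : c * b WA <= b S.
    by rewrite -(ler_pM2l Wj) eqB mulrCA mulrA ler_wpM2r.
  by apply: le_trans hB; rewrite expr2 -mulrA ler_pM2l.
have m1 := W_max S1 S1W; have m2 := W_max S2 S2W.
set q := k.+1%:R^-1 in m1 m2.
have q4 : 4 * q <= c ^+ 2.
  by rewrite /q ler_pdivrMr ?ltr0n // mulrC.
have eW0 : 0 <= e W by rewrite ler0n.
have sE : b S1 / b W + b S2 / b W = 1 - b S / b W.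
  have : (b S + b S2 + b S1) / b W = 1 by rewrite -bW divff ?gt_eqF.
  by rewrite !mulrDl; lra.
have s4 : 4 * q <= b S / b W.
  by apply: le_trans q4 _; rewrite ler_pdivlMr.
have : e W * (b S / b W / 2) <= e S.
  have : e S = e W - e S2 - e S1 by rewrite eW; ring.
  move=> ->; have : e W * (b S / b W) = e W - e W * (b S1 / b W) - e W * (b S2 / b W).
    by rewrite -[X in X - _ - _]mulr1 -!mulrBr -addrA -opprD sE; congr (_ * _); ring.
  have := ler_wpM2l eW0 s4.
  rewrite !mulrDr in m1 m2 *; move: m1 m2; rewrite [e W * (_ / 2)]mulrA; lra.
apply: le_trans.
have -> : d / 2 * b S = d * b W * (b S / b W / 2) by field; rewrite gt_eqF.
by rewrite ler_wpM2r // !divr_ge0.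
Qed.

End DenseBox.

(** * Quasirandomness of the non-edges *)

Section NonEdges.
Variables (R : realFieldType) (K : finFieldType) (I L : finType).
Variables (lay : L -> I) (D : {set K}).

Local Notation V := (L * (K * K))%type.
Implicit Types (u v w : V) (B : {set V}).

Definition layer i : {set V} := [set v | lay v.1 == i].

Definition pairing u v : K := u.2.1 * v.2.1 + u.2.2 + v.2.2.

Lemma pairingC u v : pairing u v = pairing v u.
Proof. by rewrite /pairing; ring. Qed.

Definition copies i := #|[set l | lay l == i]|.

Lemma sum_layer (F : K * K -> R) i :
  \sum_(v in layer i) F v.2 = (copies i)%:R * \sum_p F p.
Proof.
rewrite (eq_bigl (fun v => (lay v.1 == i) && true)); last first.
  by move=> v; rewrite inE andbT.
rewrite -(pair_big (fun l => lay l == i) xpredT (fun _ p => F p)) /=.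
by rewrite sumr_const mulr_natl /copies cardsE.
Qed.

Lemma card_layer i : #|layer i| = (copies i * (#|K| * #|K|))%N.
Proof.
have -> : layer i = setX [set l | lay l == i] setT.
  by apply/setP => -[l ab]; rewrite !inE /= andbT.
by rewrite cardsX cardsT card_prod.
Qed.

Lemma sum_form (g : K -> R) u i :
  \sum_(v in layer i) g (pairing u v) = (copies i * #|K|)%:R * \sum_t g t.
Proof.
rewrite (sum_layer (fun p => g (u.2.1 * p.1 + u.2.2 + p.2))) natrM -mulrA.
congr (_ * _).
rewrite -(pair_big xpredT xpredT (fun x y => g (u.2.1 * x + u.2.2 + y))) /=.
rewrite (eq_bigr (fun=> \sum_t g t)); first by rewrite sumr_const mulr_natl.
by move=> x _; rewrite [RHS](reindex_inj (addrI (u.2.1 * x + u.2.2))).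
Qed.

(** When the first field coordinates of [u] and [w] differ, the two pairings form a bijective affine
    map of [K * K], of determinant [u.2.1 - w.2.1]. Hence their values are independent and
    uniform. *)
Lemma sum_form2 (g h : K -> R) u w i : u.2.1 != w.2.1 ->
  \sum_(v in layer i) g (pairing u v) * h (pairing w v) =
  (copies i)%:R * ((\sum_t g t) * (\sum_t h t)).
Proof.
move=> uw.
pose f z (p : K * K) : K := z.1 * p.1 + z.2 + p.2.
rewrite (sum_layer (fun p => g (f u.2 p) * h (f w.2 p))); congr (_ * _).
rewrite big_distrlr pair_big /=.
rewrite [RHS](reindex_inj (h := fun p => (f u.2 p, f w.2 p))) //.
move=> [x y] [x' y'] /= []; rewrite /f /= => e1 e2.
have : (u.2.1 - w.2.1) * (x - x') = 0.
  transitivity (u.2.1 * x + u.2.2 + y - (w.2.1 * x + w.2.2 + y) -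
    (u.2.1 * x' + u.2.2 + y' - (w.2.1 * x' + w.2.2 + y'))); first by ring.
  by rewrite e1 e2 subrr.
move/eqP; rewrite mulf_eq0 !subr_eq0 (negbTE uw) /= => /eqP xx.
by move: e1; rewrite xx => /addrI->.
Qed.

Local Notation beta := (#|D|%:R / #|K|%:R : R).

Lemma card_field_gt0 : 0 < #|K|%:R :> R.
Proof. by rewrite ltr0n; apply/card_gt0P; exists 0. Qed.

Lemma card_nonneighbours u i :
  #|[set v in layer i | pairing u v \in D]|%:R = beta * #|layer i|%:R.
Proof.
transitivity (\sum_(v in layer i) (pairing u v \in D)%:R : R).
  rewrite -sum1_card natr_sum big_mkcond [RHS]big_mkcond /=.
  by apply: eq_bigr => v _; rewrite in_set; do 2!case: (_ \in _).
rewrite (sum_form (fun t => (t \in D)%:R)) card_layer.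
have -> : \sum_(t : K) (t \in D)%:R = #|D|%:R :> R.
  rewrite -sum1_card natr_sum [RHS]big_mkcond /=.
  by apply: eq_bigr => t _; case: ifP.
have := card_field_gt0 => K0.
by rewrite !natrM; field; rewrite gt_eqF.
Qed.

Let f (t : K) : R := (t \in D)%:R - beta.

Lemma beta_le1 : beta <= 1.
Proof.
by rewrite ler_pdivrMr ?card_field_gt0 // mul1r ler_nat max_card.
Qed.

Lemma sum_centered : \sum_t f t = 0.
Proof.
have K0 := card_field_gt0.
rewrite big_split /= sumr_const.
have -> : \sum_(t : K) (t \in D)%:R = #|D|%:R :> R.
  rewrite -sum1_card natr_sum [RHS]big_mkcond /=.
  by apply: eq_bigr => t _; case: ifP.
by rewrite mulNrn -[beta *+ _]mulr_natr divfK ?subrr ?gt_eqF.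
Qed.

Lemma centered_le1 s t : f s * f t <= 1.
Proof.
have b1 := beta_le1; have b0 : 0 <= beta by rewrite divr_ge0.
rewrite /f; move: beta b0 b1 => b b0 b1.
by case: (s \in D); case: (t \in D); rewrite /= ?sub0r; nra.
Qed.

(** Expand the square. Pairs [u], [w] with distinct first field coordinates have covariance zero,
    and each [u] shares that coordinate with only a [1 / #|K|] fraction of layer [j]; each such pair
    contributes at most [#|layer i|]. *)
Lemma variance i j B : B \subset layer j ->
  #|K|%:R * \sum_(v in layer i) (\sum_(u in B) f (pairing u v)) ^+ 2 <=
  #|B|%:R * #|layer i|%:R * #|layer j|%:R.
Proof.
move=> BL; have K0 := card_field_gt0.
have cov u w : \sum_(v in layer i) f (pairing u v) * f (pairing w v) <=
    #|layer i|%:R * (u.2.1 == w.2.1)%:R.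
  case: (altP (u.2.1 =P w.2.1)) => [_|uw]; last first.
    by rewrite sum_form2 // sum_centered !mulr0.
  rewrite mulr1 -sumr_const; apply: ler_sum => v _; exact: centered_le1.
have fib u : #|K|%:R * \sum_(w in B) (u.2.1 == w.2.1)%:R <= #|layer j|%:R :> R.
  apply: le_trans (_ : #|K|%:R * \sum_(w in layer j) (u.2.1 == w.2.1)%:R <= _).
    rewrite ler_wpM2l // big_mkcond [leRHS]big_mkcond /=.
    apply: ler_sum => w _; case: (boolP (w \in B)) => [/(subsetP BL)->//|_].
    by case: ifP.
  rewrite (sum_layer (fun p => (u.2.1 == p.1)%:R)) card_layer.
  rewrite -(pair_big xpredT xpredT (fun x y => (u.2.1 == x)%:R)) /=.
  under eq_bigr do rewrite sumr_const.
  rewrite (bigD1 u.2.1) //= eqxx big1 ?addr0 => [|x /negbTE]; last first.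
    by rewrite eq_sym => ->; rewrite mul0rn.
  by rewrite -!natrM ler_nat mulnCA.
have -> : \sum_(v in layer i) (\sum_(u in B) f (pairing u v)) ^+ 2 =
    \sum_(u in B) \sum_(w in B) \sum_(v in layer i) f (pairing u v) * f (pairing w v).
  under eq_bigr do rewrite expr2 big_distrlr /=.
  by rewrite exchange_big; apply: eq_bigr => u _; rewrite exchange_big.
apply: le_trans (_ : #|K|%:R * \sum_(u in B) \sum_(w in B) #|layer i|%:R * (u.2.1 == w.2.1)%:R <= _).
  by rewrite ler_wpM2l //; do 2!(apply: ler_sum => ? _); apply: cov.
rewrite big_distrr /= -mulrA [leRHS]mulr_natl -[leRHS]sumr_const.
apply: ler_sum => u _; rewrite -big_distrr /= mulrCA.
by rewrite ler_wpM2l.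
Qed.

(** Chebyshev's inequality: a vertex [v] of this set deviates by more than [beta / 2 * #|B|] from
    the mean [beta * #|B|], hence adds at least [(beta * #|B|) ^+ 2 / 4] to the sum bounded in
    [variance]. *)
Lemma few_sparse i j B : B \subset layer j ->
  #|[set v in layer i |
      #|[set u in B | pairing v u \in D]|%:R < beta / 2 * #|B|%:R]|%:R *
    (beta ^+ 2 * #|K|%:R * #|B|%:R) <= 4 * #|layer i|%:R * #|layer j|%:R :> R.
Proof.
move=> BL; set X := [set v in _ | _].
have K0 := card_field_gt0.
have [/eqP B0|B0] := posnP #|B|.
  by rewrite (eqP B0) !mulr0 mulr_ge0 ?mulr_ge0.
have le : #|X|%:R * ((beta * #|B|%:R) ^+ 2 / 4) <=
    \sum_(v in layer i) (\sum_(u in B) f (pairing u v)) ^+ 2.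
  have XL : X \subset layer i by apply/subsetP => v; rewrite inE => /andP[].
  rewrite (big_setID X) /= (setIidPr XL) -[leLHS]addr0.
  apply: lerD; last by apply: sumr_ge0 => v _; rewrite sqr_ge0.
  rewrite mulr_natl -[leLHS]sumr_const; apply: ler_sum => v; rewrite inE => /andP[_].
  have -> : \sum_(u in B) f (pairing u v) =
      #|[set u in B | pairing v u \in D]|%:R - beta * #|B|%:R.
    rewrite big_split /= sumr_const mulNrn -[beta *+ _]mulr_natr; congr (_ - _).
    rewrite -sum1_card natr_sum big_mkcond [RHS]big_mkcond /=.
    by apply: eq_bigr => u _; rewrite inE pairingC; do 2!case: (_ \in _).
  have : 0 <= #|[set u in B | pairing v u \in D]|%:R :> R by [].
  move: (#|[set u in B | _]|%:R) => x; nra.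
have := variance i BL => var.
have B0' : 0 < #|B|%:R :> R by rewrite ltr0n.
have h := le_trans (ler_wpM2l (ltW K0) le) var.
rewrite -(ler_pM2l B0'); move: h; rewrite exprMn.
move: (#|X|%:R) (beta ^+ 2) (#|B|%:R) (#|K|%:R) => x b y k h; lra.
Qed.

End NonEdges.

(** * Counting red transversal cliques *)

Section Transversals.
Variables (R : realFieldType) (s : nat) (V : finType) (red : rel V).
Local Notation I := 'I_s.+1.
Implicit Types (U W : {ffun I -> {set V}}) (x : {ffun I -> V}).

(** Coordinates from [k] on are free, so partial cliques of every length are counted inside the same
    box. *)
Definition cliques k : {set {ffun I -> V}} :=
  [set x : {ffun I -> V} | [forall i : I, forall j : I, (i < j < k)%N ==> red (x i) (x j)]].

Lemma cliquesP k x :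
  reflect (forall i j : I, (i < j < k)%N -> red (x i) (x j)) (x \in cliques k).
Proof.
rewrite inE; apply: (iffP forallP) => [H i j ij|H i].
  by move/forallP: (H i) => /(_ j)/implyP; apply.
by apply/forallP => j; apply/implyP; apply: H.
Qed.

(** Extend partial cliques one layer at a time: each of the at most [s] earlier vertices forbids at
    most a fraction [(1 - lam) / s] of the next layer, so a fraction [lam] of it remains. Only
    degrees into layers of positive index enter, which is what allows layer 0 to be small. *)
Lemma many_cliques U (lam : R) : (0 < s)%N -> 0 <= lam <= 1 ->
  (forall i, 0 < #|U i|)%N ->
  (forall (i k : I) u, (i < k)%N -> u \in U i ->
    s%:R * #|[set v in U k | ~~ red u v]|%:R <= (1 - lam) * #|U k|%:R) ->
  lam ^+ s.+1 * #|box U|%:R <= #|cliques s.+1 :&: box U|%:R.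
Proof.
move=> s0 /andP[lam0 lam1] U0 nonred.
suff ind k : (k <= s.+1)%N -> lam ^+ k * #|box U|%:R <= #|cliques k :&: box U|%:R by exact: ind.
elim: k => [_|k IHk ltk].
  rewrite expr0 mul1r ler_nat subset_leq_card //; apply/subsetP => x xU.
  by rewrite in_setI xU andbT; apply/cliquesP => i j; rewrite andbC.
pose o := Ordinal ltk.
have Uo : 0 < #|U o|%:R :> R by rewrite ltr0n.
have inner x : x \in cliques k :&: box U ->
    lam * #|U o|%:R <= #|[set v in U o | upd x o v \in cliques k.+1]|%:R.
  rewrite in_setI => /andP[/cliquesP xk /boxP xU].
  have cover : U o :\: [set v in U o | upd x o v \in cliques k.+1] \subset
      \bigcup_(i : I | (i < k)%N) [set v in U o | ~~ red (x i) v].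
    apply/subsetP => v; rewrite in_setD in_set => /andP[+ vU].
    rewrite vU /=; apply: contraNT => /bigcupP nov; apply/cliquesP => i j ijk.
    have ik : (i < k)%N by lia.
    rewrite upd_neq; last by rewrite -val_eqE /= ltn_eqF.
    have [->|jo] := eqVneq j o.
      rewrite upd_id; apply/negPn/negP => nr; apply: nov; exists i => //.
      by rewrite in_set vU.
    rewrite upd_neq //; apply: xk; move: ijk; rewrite ltnS => /andP[-> jk] /=.
    by rewrite ltn_neqAle jk andbT.
  have := subset_leq_card cover.
  have sub : [set v in U o | upd x o v \in cliques k.+1] \subset U o.
    by apply/subsetP => v; rewrite in_set => /andP[].
  have := cardsID [set v in U o | upd x o v \in cliques k.+1] (U o).
  rewrite (setIidPr sub) => /(congr1 (fun n => n%:R : R)); rewrite natrD => eqUo.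
  set X := #|[set v in U o | _]| in eqUo *; set Y := #|U o :\: _| in eqUo * => cY.
  have le1 : (Y <= \sum_(i : I | (i < k)%N) #|[set v in U o | ~~ red (x i) v]|)%N.
    apply: leq_trans cY _.
    by elim/big_ind2: _ => [|? ? ? ? h1 h2|//];
       rewrite ?cards0 // (leq_trans (leq_card_setU _ _)) ?leq_add.
  have le2 : s%:R * Y%:R <= \sum_(i : I | (i < k)%N) (1 - lam) * #|U o|%:R.
    apply: le_trans (_ : s%:R * (\sum_(i : I | (i < k)%N) #|[set v in U o | ~~ red (x i) v]|)%:R <= _).
      by rewrite ler_wpM2l // ler_nat.
    by rewrite natr_sum big_distrr /=; apply: ler_sum => i ik; apply: nonred; [exact: ik | exact: xU].
  have le3 : (\sum_(i : I | (i < k)%N) 1 <= s)%N.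
    apply: leq_trans (_ : \sum_(i < k) 1 <= s)%N.
      by rewrite (big_ord_widen _ (fun=> 1%N) (ltnW ltk)).
    by rewrite sum_nat_const card_ord muln1 -ltnS.
  move: le2; rewrite sumr_const -[leRHS]mulr_natl -sum1_card => le2.
  have s0' : 0 < s%:R :> R by rewrite ltr0n.
  have : s%:R * Y%:R <= s%:R * ((1 - lam) * #|U o|%:R).
    apply: le_trans le2 _; rewrite ler_wpM2r ?mulr_ge0 ?subr_ge0 //.
    by rewrite ler_nat.
  by rewrite ler_pM2l //; lra.
(* Resampling coordinate [o] turns the bound [inner] for each partial clique into a count of longer
   cliques. *)
have := sum_upd U o (fun x => (x \in cliques k.+1) : nat).
move/(congr1 (fun n => n%:R : R)).
have -> : (\sum_(x in box U) (x \in cliques k.+1) = #|cliques k.+1 :&: box U|)%N.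
  rewrite -sum1_card [LHS]big_mkcond [RHS]big_mkcond /=; apply: eq_bigr => x _.
  by rewrite in_setI andbC; do 2!case: (_ \in _).
rewrite natrM => eqU; rewrite -(ler_pM2l Uo) -eqU.
apply: le_trans (_ : \sum_(x in cliques k :&: box U) lam * #|U o|%:R <= _).
  rewrite sumr_const -mulr_natl exprS.
  have := ler_wpM2l (mulr_ge0 lam0 (ltW Uo)) (IHk (ltnW ltk)).
  rewrite !mulrA; move: (#|U o|%:R) (lam ^+ k) (#|box U|%:R) => a b c; lra.
rewrite natr_sum big_mkcond [leRHS]big_mkcond /=; apply: ler_sum => x _.
case: ifP => [xk|_]; last by case: ifP.
have xU : x \in box U by move: xk; rewrite in_setI => /andP[].
rewrite xU; apply: le_trans (inner x xk) _; rewrite ler_nat.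
rewrite -sum1_card big_mkcond [leqRHS]big_mkcond /=; apply: leq_sum => v _.
by rewrite in_set; case: (v \in U o) => //=; case: (_ \in _).
Qed.

(** Resample coordinate [j]: whatever [x i] is, less than a fraction [1 / E] of the choices in [W j]
    are red to it. This is played against the lower bound of [dense_box]. *)
Lemma sparse_box (C : {set {ffun I -> V}}) W i j (E : nat) : i != j ->
  (0 < #|W j|)%N ->
  (forall x, x \in C -> red (x i) (x j)) ->
  (forall u, u \in W i -> (E * #|[set v in W j | red u v]| < #|W j|)%N) ->
  (E * #|C :&: box W| <= #|box W|)%N.
Proof.
move=> ij Wj Cred sparse.
have := sum_upd W j (fun x => red (x i) (x j) : nat) => eqW.
rewrite -(leq_pmul2l Wj).
apply: (@leq_trans (E * (#|W j| * \sum_(x in box W) red (x i) (x j)))%N).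
  rewrite mulnCA 2!leq_mul2l; apply/orP; right; apply/orP; right.
  rewrite -sum1_card big_mkcond [leqRHS]big_mkcond /=; apply: leq_sum => x _.
  rewrite in_setI; case: (boolP (x \in C)) => //= xC.
  by rewrite Cred.
rewrite -eqW big_distrr /= mulnC -sum_nat_const; apply: leq_sum => x /boxP xW.
apply: leq_trans (ltnW (sparse _ (xW i))); rewrite leq_mul2l; apply/orP; right.
rewrite -sum1_card [leqRHS]big_mkcond [leqLHS]big_mkcond /=.
apply: leq_sum => v _; rewrite in_set upd_id upd_neq //.
by case: (v \in W j) => //=; case: (red _ _).
Qed.

End Transversals.

(** * Stars from independent monochromatic neighbourhoods *)

Lemma monochromatic_star (V : finType) (e c : rel V) (b : bool) (n : nat)
    (u : V) (B : {set V}) :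
  (forall x y, e x y = e y x) -> (forall x y, c x y = c y x) ->
  (forall x, e x x = false) -> {in B &, forall v w, e v w = false} ->
  {in B, forall v, e u v && (c u v == b)} -> (n <= #|B|)%N ->
  mono_induced_copy e c b (star_rel n).
Proof.
move=> e_sym c_sym e_irr Bind Bu nB.
(* Index 0 is the centre and index [j.+1] the leaf number [j] of [B]; the default of [nth] is never
   reached, as [n <= #|B|]. *)
pose phi (i : 'I_n.+1) := if val i is j.+1 then nth u (enum B) j else u.
have phiB (i : 'I_n.+1) j : val i = j.+1 -> phi i \in B.
  move=> ij; rewrite /phi ij -mem_enum mem_nth // -cardE.
  by apply: leq_trans nB; rewrite -ltnS -ij ltn_ord.
have uB : u \notin B.
  by apply/negP => /Bu; rewrite e_irr.
have phiB0 (i : 'I_n.+1) : (0 < val i)%N -> phi i \in B.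
  by move=> i0; rewrite (phiB i (val i).-1) ?prednK.
have phi0 (i : 'I_n.+1) : val i = 0%N -> phi i = u by move=> i0; rewrite /phi i0.
exists phi; split; [|split].
- move=> x y; case: (posnP (val x)) => x0; case: (posnP (val y)) => y0.
  + by move=> _; apply: val_inj; rewrite x0 y0.
  + rewrite (phi0 _ x0) => E; move: uB; rewrite E.
    by rewrite phiB0.
  + rewrite (phi0 _ y0) => E; move: uB; rewrite -E.
    by rewrite phiB0.
  move=> /eqP; rewrite /phi.
  move: x0 y0.
  case Ex: (val x) => [|i] //; case Ey: (val y) => [|j] // _ _.
  rewrite nth_uniq ?enum_uniq -?cardE //.
  + by move/eqP => ij; apply: val_inj; rewrite Ex Ey ij.
  + by apply: leq_trans nB; have := ltn_ord x; rewrite [nat_of_ord x]Ex.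
  + by apply: leq_trans nB; have := ltn_ord y; rewrite [nat_of_ord y]Ey.
- move=> x y; rewrite /star_rel.
  case: (posnP (val x)) => x0; case: (posnP (val y)) => y0.
  + by rewrite !phi0 // e_irr -val_eqE /= x0 y0.
  + have /Bu/andP[uy _] : phi y \in B by rewrite phiB0.
    by rewrite (phi0 x) // uy -val_eqE /=; move: x0 y0 => /= ->; case: (nat_of_ord y).
  + have /Bu/andP[ux _] : phi x \in B by rewrite phiB0.
    by rewrite (phi0 y) // e_sym ux -val_eqE /=; move: y0 x0 => /= ->; case: (nat_of_ord x).
  rewrite Bind ?phiB0 //.
  by move: x0 y0 => /=; case: (nat_of_ord x) => // ?; case: (nat_of_ord y) => // ?; rewrite andbF.
move=> x y; rewrite /star_rel => /andP[xy /orP[]/eqP z0].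
  have y0 : (0 < val y)%N.
    by rewrite lt0n; apply: contraNneq xy => y0; rewrite -val_eqE /= z0 y0.
  have /Bu/andP[_ /eqP uy] : phi y \in B by rewrite phiB0.
  by rewrite (phi0 x).
have x0 : (0 < val x)%N.
  by rewrite lt0n; apply: contraNneq xy => x0; rewrite -val_eqE /= z0 x0.
have /Bu/andP[_ /eqP ux] : phi x \in B by rewrite phiB0.
by rewrite (phi0 y) // c_sym.
Qed.

(** * The host graph and the red induced copy of H *)

Section Host.
Variables (K : finFieldType) (L : finType) (s : nat) (lay : L -> 'I_s.+1).
Variable D : {set K}.
Local Notation V := (L * (K * K))%type.

Definition host : rel V :=
  fun u v => (lay u.1 != lay v.1) && (pairing u v \notin D).

Lemma host_simple : simple_graph host.
Proof.
by split=> [u v|u]; rewrite /host ?eqxx // eq_sym pairingC.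
Qed.

Variables (R : realFieldType) (T : finType) (eH : rel T) (f : T -> 'I_s.+1).
Variables (n E Q k : nat) (lam : R).
Hypotheses (eH_simple : simple_graph eH) (f_proper : forall x y, eH x y -> f x != f y).
Local Notation beta := (#|D|%:R / #|K|%:R : R).
Local Notation d := (lam ^+ s.+1).
Local Notation U i := (#|layer K lay i|).
Hypotheses (s_gt0 : (0 < s)%N) (lam_gt0 : 0 < lam) (lam_le1 : lam <= 1).
Hypothesis U_gt0 : forall i, (0 < U i)%N.
Hypothesis blue_few : forall i, i != ord0 ->
  s%:R * (beta * (U i)%:R + n%:R) <= (1 - lam) * (U i)%:R.
Hypotheses (E_ge2 : (2 <= E)%N) (dE : 2 < d * E%:R) (betaE : 2 <= beta * E%:R).
Hypotheses (leQ : (#|T| * E ^ #|T| <= Q)%N) (Q_gt0 : (0 < Q)%N).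
Hypothesis leQk : (4 * Q ^ 2 <= k.+1)%N.
Hypothesis U_large : forall i, Q%:R < d ^+ k.+1 * (U i)%:R.
Hypothesis K_large : 4 * Q%:R ^+ 2 < beta ^+ 2 * #|K|%:R * (d ^+ k.+1) ^+ 2.

Variable c : rel V.
Hypothesis c_sym : forall u v, c u v = c v u.
Hypothesis no_star : ~ mono_induced_copy host c false (star_rel n).

Definition red_adj : rel V := fun u v => host u v && c u v.

(** A vertex of layer [j] that is not red to [u] is a non-neighbour, of which there are exactly
    [beta * #|layer j|], or a blue neighbour. Layers are independent, so [n] blue neighbours would
    span a blue induced star. *)
Lemma nonred_few (i j : 'I_s.+1) u : (i < j)%N -> u \in layer K lay i ->
  s%:R * #|[set v in layer K lay j | ~~ red_adj u v]|%:R <= (1 - lam) * (U j)%:R :> R.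
Proof.
move=> ij ui; apply: le_trans (blue_few (i := j) _); last first.
  by apply: contraTneq ij => ->.
rewrite ler_wpM2l // -(card_nonneighbours R lay D u).
set X := [set v in _ | pairing u v \in D].
set B := [set v in layer K lay j | host u v && ~~ c u v].
have ltB : (#|B| < n)%N.
  rewrite ltnNge; apply/negP => nB; apply: no_star.
  have [h_sym h_irr] := host_simple.
  apply: (monochromatic_star (B := B) (u := u)) => //.
    move=> v w; rewrite !inE => /andP[/eqP vj _] /andP[/eqP wj _].
    by rewrite /host vj wj eqxx.
  by move=> v; rewrite !inE => /andP[_ /andP[-> /negbTE->]].
rewrite -natrD ler_nat; apply: leq_trans (_ : #|X| + #|B| <= _)%N; last first.
  by rewrite leq_add2l ltnW.
apply: leq_trans (leq_card_setU X B); apply/subset_leq_card/subsetP => v.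
rewrite !inE => /andP[vj]; rewrite vj /= negb_and /red_adj.
have uv : lay u.1 != lay v.1.
  move: ui; rewrite inE => /eqP->; rewrite (eqP vj).
  by apply: contraTneq ij => ->; rewrite ltnn.
by rewrite /host uv /=; case: (_ \in D).
Qed.

(** The clause [u != v] yields injectivity; non-adjacency alone would not exclude [u = v], since
    [host] is irreflexive. *)
Definition allowed (x y : T) : rel V := fun u v =>
  (u != v) && (if eH x y then red_adj u v else ~~ host u v).

(** [embed] is applied inside the box from [dense_box]. Its bound on atypical vertices is checked in
    three cases: same layer, edge of H, and non-edge of H between distinct layers. *)
Lemma red_copy : mono_induced_copy host c true eH.
Proof.
have [h_sym h_irr] := host_simple.
have [H_sym H_irr] := eH_simple.
pose UU : {ffun 'I_s.+1 -> {set V}} := [ffun i => layer K lay i].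
pose C := cliques s red_adj s.+1.
have d0 : 0 < d by rewrite exprn_gt0.
have U0 i : (0 < #|UU i|)%N by rewrite ffunE.
have box0 : (0 < #|box UU|)%N.
  apply/card_gt0P.
  have ex i : exists v, v \in UU i by apply/card_gt0P.
  pose x := [ffun i => xchoose (ex i)].
  by exists x; apply/boxP => i; rewrite ffunE; apply: xchooseP.
have dC : d * #|box UU|%:R <= #|C :&: box UU|%:R :> R.
  apply: many_cliques => //; first by rewrite lam_le1 ltW.
  by move=> i j u ij; rewrite !ffunE; apply: nonred_few.
have Q0 : 0 < Q%:R :> R by rewrite ltr0n.
have c0 : 0 < Q%:R^-1 :> R by rewrite invr_gt0.
have kc : 4 <= k.+1%:R * Q%:R^-1 ^+ 2 :> R.
  rewrite exprVn ler_pdivlMr ?exprn_gt0 // -natrX -natrM ler_nat //.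
have [W [WU Wlarge W0 Wdense]] := dense_box d0 box0 dC c0 kc.
have WL i : W i \subset layer K lay i by have := WU i; rewrite ffunE.
have Wl i : d ^+ k.+1 * (U i)%:R <= #|W i|%:R by have := Wlarge i; rewrite ffunE.
have QW i : (Q < #|W i|)%N by rewrite -(ltr_nat R) (lt_le_trans (U_large i)).
have Wgt0 i : (0 < #|W i|)%N by apply: leq_trans (QW i).
have Wlay i u : u \in W i -> lay u.1 = i.
  by move=> /(subsetP (WL i)); rewrite inE => /eqP.
have E0 : (0 < E)%N := ltnW E_ge2.
have [||x y B xy BW cB|phi [phiW phiR]] :=
  @embed T V allowed (fun x => W (f x)) E Q _ E0 _ leQ.
- by move=> x y u v; rewrite /allowed eq_sym H_sym /red_adj h_sym c_sym.
- by [].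
- set X := atypical _ _ _ _ _ _.
  have B0 : (1 < #|B|)%N.
    rewrite ltnNge; apply/negP => B1.
    have := leq_trans cB (leq_mul (leqnn Q) B1).
    by rewrite muln1 leqNgt QW.
  have XW : X \subset W (f x) by apply/subsetP => u; rewrite inE => /andP[].
  (* Inside one layer only [u] itself is forbidden, and [B] has at least two elements, so with
     [E >= 2] no vertex is atypical. *)
  have [xyf|xyf] := eqVneq (f x) (f y).
    suff -> : X = set0 by rewrite cards0 muln0.
    apply/setP => u; rewrite !inE; apply/negP => /andP[uW].
    have -> : nbhd allowed x y u B = B :\ u.
      apply/setP => v; rewrite !inE /allowed andbC eq_sym.
      case: (boolP (v \in B)) => vB; rewrite ?andbF //= !andbT.
      rewrite ifF; last by apply/negP => /f_proper; rewrite xyf eqxx.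
      rewrite /host (Wlay _ _ uW) (Wlay (f x)) ?eqxx ?andbT //.
      by rewrite xyf (subsetP BW).
    move: B0; rewrite (cardsD1 u B) ltnNge => B0; apply/negP; rewrite -leqNgt.
    apply: leq_trans (leq_mul E_ge2 (leqnn _)); rewrite mul2n -addnn leq_add2r.
    apply: leq_trans (leq_b1 _) _; rewrite lt0n; apply: contra B0 => /eqP->.
    by rewrite addn0 leq_b1.
  case eHxy: (eH x y).
    (* If [X] were large, the subbox with [X] and [B] in the two layers would have clique density at
       least [d / 2] by [Wdense], yet at most [1 / E] by [sparse_box]; this contradicts [dE]. *)
    rewrite ltnNge; apply/negP => XQ.
    pose S := upd (upd W (f x) X) (f y) B.
    have leX : Q%:R^-1 * #|W (f x)|%:R <= #|X|%:R :> R.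
      by rewrite mulrC ler_pdivrMr // mulrC -natrM ler_nat.
    have leB : Q%:R^-1 * #|W (f y)|%:R <= #|B|%:R :> R.
      by rewrite mulrC ler_pdivrMr // mulrC -natrM ler_nat.
    have := Wdense (f x) (f y) X B xyf XW BW leX leB; rewrite -/S => dS.
    have Sx : S (f x) = X by rewrite upd_neq // upd_id.
    have Sy : S (f y) = B by rewrite upd_id.
    have X0 : (0 < #|X|)%N.
      by rewrite lt0n; apply: contraTneq XQ => ->; rewrite muln0 -ltnNge.
    have S0 : (0 < #|box S|)%N.
      have ex i : exists v, v \in S i.
        rewrite /S ffunE; case: eqP => _; first by apply/card_gt0P/ltnW.
        by rewrite ffunE; case: eqP => _; apply/card_gt0P.
      apply/card_gt0P; exists [ffun i => xchoose (ex i)].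
      by apply/boxP => i; rewrite ffunE; apply: xchooseP.
    have : (E * #|C :&: box S| <= #|box S|)%N.
      apply: (@sparse_box s V red_adj C S (f x) (f y)) => //.
      - by rewrite Sy ltnW.
      - move=> z /cliquesP zC; have [lt|gt|/val_inj eq] := ltngtP (f x) (f y).
        + by apply: zC; rewrite lt /=.
        + by rewrite /red_adj h_sym c_sym; apply: zC; rewrite gt /=.
        + by rewrite eq eqxx in xyf.
      move=> u; rewrite Sx Sy inE => /andP[uW]; apply: leq_trans.
      rewrite ltnS leq_mul2l; apply/orP; right; apply/subset_leq_card/subsetP => v.
      rewrite !inE /allowed eHxy => /andP[-> red]; rewrite red andbT /=.
      by apply: contraTneq red => ->; rewrite /red_adj h_irr.
    rewrite -(ler_nat R) natrM => leE.
    have S0' : 0 < #|box S|%:R :> R by rewrite ltr0n.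
    have E0' : 0 < E%:R :> R by rewrite ltr0n.
    have := le_trans (ler_wpM2l (ltW E0') dS) leE.
    have := S0'; have := dE; move: (d) (E%:R) (#|box S|%:R) => {}d e z; nra.
  (* By [betaE], [1 / E <= beta / 2], so atypical vertices are sparse in the sense of
     [few_sparse]. *)
  have XB : X \subset [set v in layer K lay (f x) |
      #|[set u in B | pairing v u \in D]|%:R < beta / 2 * #|B|%:R].
    apply/subsetP => u; rewrite !inE => /andP[uW uX].
    rewrite (Wlay _ _ uW) eqxx /=.
    have -> : [set v in B | pairing u v \in D] = nbhd allowed x y u B.
      apply/setP => v; rewrite !inE /allowed eHxy /host (Wlay _ _ uW).
      case: (boolP (v \in B)) => //= vB.
      rewrite (Wlay (f y)) ?(subsetP BW) // xyf /= negbK.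
      case: eqP => [uv|//].
      move: xyf; rewrite -(Wlay _ _ uW) uv (Wlay (f y)) ?(subsetP BW) //.
      by rewrite eqxx.
    move: uX; rewrite -(ltr_nat R) natrM.
    have E0' : 0 < E%:R :> R by rewrite ltr0n.
    have B0' : 0 <= #|B|%:R :> R by [].
    move: betaE B0' E0'; move: beta (E%:R) (#|B|%:R) (#|nbhd _ _ _ _ _|%:R) => b e z w.
    nra.
  have := subset_leq_card XB; rewrite -(ler_nat R) => leX.
  have BL : B \subset layer K lay (f y) by apply: subset_trans (WL _).
  have few := few_sparse R D (f x) BL.
  move: leX few; set Y := (#|[set v in layer K lay (f x) | _]|%:R) => leX few.
  rewrite -(ltr_nat R) natrM ltNge; apply/negP => QX.
  have B0' : 0 < #|B|%:R :> R by rewrite ltr0n ltnW.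
  have cB' : #|W (f y)|%:R <= Q%:R * #|B|%:R :> R by rewrite -natrM ler_nat.
  (* If [X] were large, [Y] and [#|B|] would both be at least a fraction [d ^+ k.+1 / Q] of their
     layers. Multiplying these bounds and inserting [few] contradicts [K_large]. *)
  have hx := le_trans (Wl (f x)) (le_trans QX (ler_wpM2l (ltW Q0) leX)).
  have hy := le_trans (Wl (f y)) cB'.
  have b0 : 0 <= beta ^+ 2 * #|K|%:R by rewrite mulr_ge0 ?sqr_ge0.
  have a0 : 0 <= d ^+ k.+1 by rewrite exprn_ge0 // ltW.
  have hxy := ler_pM (mulr_ge0 a0 (ler0n _ _)) (mulr_ge0 a0 (ler0n _ _)) hx hy.
  have h1 := ler_wpM2l b0 hxy.
  have UxUy : 0 < (U (f x))%:R * (U (f y))%:R :> R by rewrite mulr_gt0 ?ltr0n.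
  have h3 := K_large; rewrite -(ltr_pM2r UxUy) in h3.
  have h4 := ler_wpM2l (sqr_ge0 (Q%:R : R)) few.
  move: h1 h3 h4; move: (d ^+ k.+1) (U (f x))%:R (U (f y))%:R (Q%:R) (#|B|%:R) (beta ^+ 2) (#|K|%:R) (Y).
  move=> a ux uy q bb b2 kk yy h1 h3 h4.
  have e1 : b2 * kk * (a * ux * (a * uy)) = b2 * kk * a ^+ 2 * (ux * uy) by ring.
  have e2 : b2 * kk * (q * yy * (q * bb)) = q ^+ 2 * (yy * (b2 * kk * bb)) by ring.
  have e3 : q ^+ 2 * (4 * ux * uy) = 4 * q ^+ 2 * (ux * uy) by ring.
  lra.
exists phi; split; [|split].
- move=> x y; apply: contra_eq => xy.
  by have := phiR x y xy; rewrite /allowed => /andP[].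
- move=> x y; have [->|xy] := eqVneq x y; first by rewrite h_irr H_irr.
  have := phiR x y xy; rewrite /allowed /red_adj => /andP[_].
  by case: (eH x y) => [/andP[]|/negbTE].
move=> x y xyH; have xy : x != y by apply: contraTneq xyH => ->; rewrite H_irr.
by have := phiR x y xy; rewrite /allowed xyH /red_adj => /andP[_ /andP[]].
Qed.

End Host.

(** * Upper bounds on IR from a host on any finite type *)

Lemma IR_le_card (R : realType) (T1 T2 V : finType) (eH : rel T1) (eG : rel T2)
    (e : rel V) (x : R) :
  simple_graph e -> ind_arrows e eH eG -> #|V|%:R <= x -> IR_le eH eG x.
Proof.
move=> [e_sym e_irr] e_arrows Vx.
pose e' : rel 'I_#|V| := fun u v => e (enum_val u) (enum_val v).
have copy (c : rel 'I_#|V|) b (T : finType) (eT : rel T) :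
    mono_induced_copy e (fun u v => c (enum_rank u) (enum_rank v)) b eT ->
    mono_induced_copy e' c b eT.
  move=> [phi [phi_inj [phi_ind phi_mono]]]; exists (enum_rank \o phi).
  split; first by move=> y z /enum_rank_inj/phi_inj.
  by split=> [y z|y z /phi_mono//]; rewrite /e' /= !enum_rankK.
exists #|V|, e'; split; first by split=> [u v|u]; rewrite /e'.
split=> // c c_sym.
have [u v|red|blue] := e_arrows (fun u v => c (enum_rank u) (enum_rank v)).
- exact: c_sym.
- by left; apply: copy.
by right; apply: copy.
Qed.

(** With no edge to colour, H is its own host. This settles chromatic number at most 1. *)
Lemma IR_le_edgeless (R : realType) (T1 T2 : finType) (eH : rel T1)
    (eG : rel T2) (x : R) :
  (forall u v, eH u v = false) -> #|T1|%:R <= x -> IR_le eH eG x.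
Proof.
move=> eH0; apply: (IR_le_card (e := eH)) => //.
  by split=> [u v|u]; rewrite !eH0.
move=> c _; left; exists id; split=> //; split=> // u v; by rewrite eH0.
Qed.

Lemma nat_above (R : realType) (x : R) : exists N : nat, x < N%:R.
Proof. by exists (Num.truncn x).+1; apply: truncnS_gt. Qed.

(** * Layer sizes of the concrete host *)

Section Layers.
Variables (s M : nat) (K : finFieldType).

(** [None] labels the single copy of [K * K] in the small layer; each of the [s] large layers has
    [M] copies. *)
Definition layer_of (l : option ('I_s * 'I_M)) : 'I_s.+1 :=
  if l is Some ij then lift ord0 ij.1 else ord0.

Lemma card_layer_ord0 : #|layer K layer_of ord0| = (#|K| * #|K|)%N.
Proof.
rewrite card_layer /copies.
suff -> : [set l | layer_of l == ord0] = [set None] by rewrite cards1 mul1n.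
by apply/setP => -[l|]; rewrite !inE //= eq_sym (negbTE (neq_lift _ _)).
Qed.

Lemma card_layer_lift i : i != ord0 ->
  #|layer K layer_of i| = (M * (#|K| * #|K|))%N.
Proof.
rewrite eq_sym => /unlift_some[j -> _]; rewrite card_layer /copies.
suff -> : [set l | layer_of l == lift ord0 j] = [set Some (j, m) | m : 'I_M].
  by rewrite card_imset ?card_ord // => m m' [].
apply/setP => -[[i' m]|]; rewrite !inE /=.
  rewrite (inj_eq lift_inj); apply/eqP/imsetP => [->|[m' _ [->]]//].
  by exists m.
by rewrite (negbTE (neq_lift _ _)); apply/esym/imsetP => -[].
Qed.

Lemma card_layered : #|{: option ('I_s * 'I_M) * (K * K)}| =
  ((s * M).+1 * (#|K| * #|K|))%N.
Proof. by rewrite !card_prod card_option card_prod !card_ord. Qed.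

End Layers.

(** * Choice of the parameters *)

Lemma small_parameter (R : realType) (gamma : R) s : 0 < gamma -> exists2 N : nat, (4 <= N)%N &
  8 * s%:R ^+ 2 <= gamma * N%:R.
Proof.
move=> gamma_gt0; have [N NP] := nat_above (8 * s%:R ^+ 2 / gamma).
exists (N + 4)%N; first by rewrite leq_addl.
rewrite ltr_pdivrMr // in NP; rewrite natrD mulrDr mulrC in NP *.
by rewrite (le_trans (ltW NP)) // mulrC lerDl mulr_ge0 // ltW.
Qed.

(** The choices are made in the order [E], [Q], [k], [p], each large in terms of the previous ones.
    None depends on the size of the star, so the field stays fixed. *)
Lemma embedding_parameters (R : realType) (lam : R) s m q : 0 < lam -> (0 < q)%N ->
  exists E Q k p : nat, [/\ [/\ (2 <= E)%N, 2 < lam ^+ s.+1 * E%:R,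
      (4 * q <= E)%N, (m * E ^ m <= Q)%N & (0 < Q)%N],
    (4 * Q ^ 2 <= k.+1)%N, prime p, (q <= p)%N &
    Q%:R < (lam ^+ s.+1) ^+ k.+1 * p%:R /\
    16 * q%:R ^+ 2 * Q%:R ^+ 2 < p%:R * ((lam ^+ s.+1) ^+ k.+1) ^+ 2].
Proof.
move=> lam0 q0; set d := lam ^+ s.+1.
have d0 : 0 < d by rewrite exprn_gt0.
have [E0 E0P] := nat_above (2 / d).
pose E := (E0 + 4 * q)%N; pose Q := (m * E ^ m).+1; pose k := (4 * Q ^ 2)%N.
pose a := d ^+ k.+1; have a0 : 0 < a by rewrite exprn_gt0.
have [P1 P1P] := nat_above (Q%:R / a).
have [P2 P2P] := nat_above (16 * q%:R ^+ 2 * Q%:R ^+ 2 / a ^+ 2).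
have [p pP p_prime] := prime_above (P1 + P2 + q).
have p1 : P1%:R <= p%:R :> R by rewrite ler_nat; lia.
have p2 : P2%:R <= p%:R :> R by rewrite ler_nat; lia.
exists E, Q, k, p; split=> //.
- split=> //; [by rewrite /E; lia| |exact: leq_addl].
  rewrite mulrC -ltr_pdivrMr //; apply: lt_le_trans E0P _.
  by rewrite ler_nat leq_addr.
- by lia.
split; first by rewrite mulrC -ltr_pdivrMr // (lt_le_trans P1P).
by rewrite -ltr_pdivrMr ?exprn_gt0 // (lt_le_trans P2P).
Qed.

(** Any set of [#|K| %/ q] elements works: as [q <= #|K|], rounding down loses at most a factor
    2. *)
Lemma density_bounds (R : realFieldType) (K : finFieldType) q :
  (0 < q)%N -> (q <= #|K|)%N ->
  exists D : {set K}, let beta := #|D|%:R / #|K|%:R : R in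
    beta * q%:R <= 1 /\ 1 <= 2 * q%:R * beta.
Proof.
move=> q0 qK; pose t := (#|K| %/ q)%N.
have tK : (t <= #|K|)%N by apply: leq_div.
have t0 : (0 < t)%N by rewrite divn_gt0.
exists [set x in take t (enum K)] => beta.
have K0 : 0 < #|K|%:R :> R by apply: card_field_gt0.
have Dt : #|[set x in take t (enum K)]| = t.
  by rewrite cardsE (card_uniqP _) ?take_uniq ?enum_uniq // size_takel // -cardE.
split.
  by rewrite /beta Dt mulrAC ler_pdivrMr // mul1r -natrM ler_nat leq_trunc_div.
rewrite /beta Dt mulrA ler_pdivlMr // mul1r -!natrM ler_nat.
have := ltn_ceil #|K| q0; rewrite -/t; nia.
Qed.

(** * Assembly of the bound *)

Lemma IR_star_bound (R : realType) (gamma : R) (T : finType) (eH : rel T)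
    (s : nat) (f : T -> 'I_s.+1) :
  0 < gamma -> (0 < s)%N -> simple_graph eH ->
  (forall x y, eH x y -> f x != f y) ->
  exists n0 : nat, forall n : nat, (n0 < n)%N ->
    IR_le eH (star_rel n) (s%:R ^+ 2 * n%:R + gamma * n%:R).
Proof.
move=> g0 s0 eH_simple f_proper.
have [N N4 Ng] := small_parameter s g0.
have N0 : 0 < N%:R :> R by rewrite ltr0n; lia.
pose lam : R := N%:R^-1; have lam0 : 0 < lam by rewrite invr_gt0.
have lamN : lam * N%:R = 1 by rewrite mulVf // gt_eqF.
have N4' : 4 <= N%:R :> R by rewrite ler_nat.
have lam4 : 4 * lam <= 1 by nra.
have glam : 8 * s%:R ^+ 2 * lam <= gamma by rewrite ler_pdivrMr.
have q0 : (0 < s * N)%N by rewrite muln_gt0 s0; lia.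
have [E [Q [k [p [[E2 dE E4 leQ Q0] leQk p_prime qp [Qp Kp]]]]]] :=
  embedding_parameters s #|T| lam0 q0.
have Kcard : #|'F_p| = p := card_Fp p_prime.
have [D [Dle Dge]] : exists D : {set 'F_p}, let beta := #|D|%:R / #|'F_p|%:R : R in
    beta * (s * N)%:R <= 1 /\ 1 <= 2 * (s * N)%:R * beta.
  by apply: density_bounds; rewrite ?Kcard.
(* Beyond [n0], the small layer and the rounding of the large ones, together [(s + 1) * p ^+ 2]
   vertices, cost at most [gamma * n / 2]. *)
have [n0 n0P] := nat_above (2 * (s%:R + 1) * p%:R ^+ 2 / gamma).
exists n0 => n nn0.
have p0 : 0 < p%:R :> R by rewrite ltr0n prime_gt0.
have p20 : 0 < p%:R ^+ 2 :> R by rewrite exprn_gt0.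
(* A large layer of [M] copies has [M * p ^+ 2] vertices, so [M], just above [y], makes it slightly
   larger than [s * n * (1 + 4 * lam)]. *)
pose y : R := s%:R * n%:R * (1 + 4 * lam) / p%:R ^+ 2.
have y0 : 0 <= y by rewrite !mulr_ge0 ?invr_ge0 ?addr_ge0 ?mulr_ge0 // ltW.
pose M := (Num.truncn y).+1.
have yM : s%:R * n%:R * (1 + 4 * lam) <= M%:R * p%:R ^+ 2.
  by rewrite -ler_pdivrMr // ltW // truncnS_gt.
have My : M%:R * p%:R ^+ 2 <= s%:R * n%:R * (1 + 4 * lam) + p%:R ^+ 2.
  rewrite -[M%:R]natr1 mulrDl mul1r lerD2r -ler_pdivlMr //.
  by rewrite truncn_le.
have s0' : 0 < s%:R :> R by rewrite ltr0n.
set beta := #|D|%:R / _ in Dle Dge.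
have b0 : 0 < beta by rewrite ltNge; apply/negP => b0; move: Dge; have := ler0n R (s * N); nra.
have sb : s%:R * beta <= lam.
  by rewrite -(ler_pM2r N0) lamN (le_trans _ Dle) // natrM [leRHS]mulrA [beta * s%:R]mulrC.
have Usize i : (p%:R : R) <= #|layer 'F_p (@layer_of s M) i|%:R.
  rewrite ler_nat; have [->|i0] := eqVneq i ord0.
    by rewrite card_layer_ord0 Kcard leq_pmulr // prime_gt0.
  by rewrite card_layer_lift // Kcard mulnCA leq_pmulr // muln_gt0 (prime_gt0 p_prime).
apply: (@IR_le_card _ _ _ _ _ _ (host (@layer_of s M) D)).
- exact: host_simple.
- move=> c c_sym.
  have [blue|no_blue] := boolp.EM (mono_induced_copy (host (@layer_of s M) D) c false (star_rel n)).
    by right.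
  left.
  apply: (red_copy (f := f) (n := n) (E := E) (Q := Q) (k := k) (lam := lam)) => //.
  + by nra.
  + by move=> i; rewrite -(ltr0n R); apply: lt_le_trans (Usize i).
  (* As [s * beta <= lam], it suffices that [s * n] is at most [1 - 2 * lam] times the layer size.
     This holds because [(1 - 2 * lam) * (1 + 4 * lam) >= 1] when [4 * lam <= 1]. *)
  + move=> i i0; rewrite -/beta card_layer_lift // Kcard natrM natrM -expr2.
    have Mp : 0 <= M%:R * p%:R ^+ 2 :> R by rewrite mulr_ge0 // ltW.
    have n0' : 0 <= s%:R * n%:R :> R by rewrite mulr_ge0.
    rewrite mulrDr mulrA; move: yM Mp n0' sb lam0 lam4.
    move: (M%:R * _) (s%:R * n%:R) (s%:R * beta) (lam) => u v w l yM Mp v0 wl l0 l4.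
    have := ler_wpM2r Mp wl.
    have : 0 <= l * v * (1 - 4 * l) by rewrite !mulr_ge0 ?subr_ge0 // ltW.
    have l2 : 0 <= 1 - 2 * l by lra.
    by have := ler_wpM2l l2 yM; lra.
  + have E4' : 4 * (s * N)%:R <= E%:R :> R by rewrite -natrM ler_nat.
    rewrite -/beta; have := ler_wpM2l (ltW b0) E4'; move: Dge.
    by move: (beta) (E%:R) ((s * N)%:R) => b e t; lra.
  + by move=> i; apply: lt_le_trans Qp _; rewrite ler_wpM2l // !exprn_ge0 // ltW.
  rewrite -/beta Kcard.
  set a := (_ ^+ k.+1) in Kp *.
  set qq := (s * N)%:R in Dge Kp.
  (* Squaring the lower bound on [beta] turns [Kp], which carries the factor [16 * qq ^+ 2], into
     the required bound with factor 4. *)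
  have b1 : 1 <= 4 * qq ^+ 2 * beta ^+ 2 by have := ler_pM ler01 ler01 Dge Dge; move: (beta) (qq) => b t; lra.
  have qq0 : 0 < 4 * qq ^+ 2 by rewrite mulr_gt0 ?exprn_gt0 // /qq ltr0n.
  have a2 : 0 <= p%:R * a ^+ 2 by rewrite mulr_ge0 ?sqr_ge0 // ltW.
  rewrite -(ltr_pM2l qq0); have := ler_wpM2r a2 b1; lra.
rewrite card_layered Kcard natrM natrM -expr2 -natr1 natrM.
(* The excess over [s ^+ 2 * n] is [4 * s ^+ 2 * lam * n], at most [gamma * n / 2] by [glam], plus
   [(s + 1) * p ^+ 2], which takes the other half. *)
have gn : 2 * (s%:R + 1) * p%:R ^+ 2 <= gamma * n%:R.
  have := ltW (lt_le_trans n0P (_ : n0%:R <= n%:R)).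
  by rewrite ler_pdivrMr // [n%:R * _]mulrC; apply; rewrite ler_nat ltnW.
have := ler_wpM2l (ltW s0') My.
have := ler_wpM2r (ler0n R n) glam.
nra.
Qed.

Theorem theorem2 (R : realType) (gamma : R) (T : finType) (eH : rel T)
    (r : nat) :
  0 < gamma -> simple_graph eH -> chromatic_number eH r ->
  exists n0 : nat, forall n : nat, (n0 < n)%N ->
    IR_le eH (star_rel n)
      ((r%:R - 1) ^+ 2 * n%:R + gamma * n%:R).
Proof.
move=> g0 eH_simple [[f f_proper] _].
(* A proper colouring with at most one colour leaves no edges, and [n0] then only has to make
   [gamma * n] exceed [#|T|]. *)
have [r1|r2] := leqP r 1.
  have [n0 n0P] := nat_above (#|T|%:R / gamma).
  exists n0 => n nn0; apply: IR_le_edgeless.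
    move=> u v; apply/negP => /f_proper/negP; apply; apply/eqP/val_inj.
    by have := ltn_ord (f u); have := ltn_ord (f v) => /=; lia.
  apply: le_trans (_ : gamma * n%:R <= _).
    rewrite mulrC -ler_pdivrMr // (le_trans (ltW n0P)) // ler_nat ltnW //.
  by rewrite lerDr mulr_ge0 // sqr_ge0.
case: r r2 f f_proper => // s s0 f f_proper.
have [n0 n0P] := IR_star_bound g0 s0 eH_simple f_proper.
by exists n0 => n /n0P; rewrite -natr1 addrK.
Qed.
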